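(* Let $k$ be a field and let $I$ be a monomial ideal of $S=k[x_1,\ldots,x_n]$ with linear quotients, generated in degree $q$. Then $I$ is a constructible ideal.
   Context: A monomial ideal $I$ has linear quotients if its minimal monomial generators can be ordered $u_1,\ldots,u_m$ such that for every $2\le i\le m$ the colon ideal $(u_1,\ldots,u_{i-1}):u_i$ is generated by a subset of the variables. A monomial ideal of $S$ generated in a single degree $q$ is a constructible ideal if it can be obtained by the following recursive procedure: (i) if $u$ is a monomial of $S$ and $I=(u)$, then $I$ is constructible; (ii) if $I_1,I_2$ are constructible ideals generated in degree $q$ and $I_1\cap I_2$ is a constructible ideal generated in degree $q+1$, then $I_1+I_2$ is a constructible ideal. *)

(* Defs.v *)
From mathcomp Require Export all_boot all_algebra.
From mathcomp Require Export classical_sets.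
From mathcomp Require Export mpoly.
Set Implicit Arguments.
Unset Strict Implicit.
Unset Printing Implicit Defensive.
Import GRing.Theory.
Local Open Scope classical_set_scope.
Local Open Scope ring_scope.

Section MonomialIdeals.
Context {k : fieldType} {n : nat}.
Local Notation S := {mpoly k[n]}.
Implicit Types (I J : set S) (G : set S) (M : set 'X_{1..n}).

(* Not ring_quotient's [idealr_closed], which excludes the unit ideal. *)
Definition is_ideal I : Prop :=
  [/\ I 0,
      forall f g, I f -> I g -> I (f + g)
    & forall a f, I f -> I (a * f)].

Definition ideal_span G : set S := smallest is_ideal G.

Definition ideal_sum I J : set S := [set f + g | f in I & g in J].

Definition ideal_colon I (f : S) : set S := [set g | I (g * f)].

Definition monomial_span M : set S := ideal_span [set 'X_[m] | m in M].

Definition monomial_ideal I : Prop := exists M, I = monomial_span M.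

(* The zero ideal ([M = set0]) satisfies this for every [q]. *)
Definition monomial_ideal_in_degree (q : nat) I : Prop :=
  exists2 M, (forall m, M m -> mdeg m = q) & I = monomial_span M.

(* The minimal monomial generators of a monomial ideal are its unique
   irredundant set of monomial generators. *)
Definition minimal_monomial_generators I M : Prop :=
  monomial_span M = I /\
  forall M', M' `<=` M -> monomial_span M' = I -> M' = M.

(* Indices are 0-based: [nth 0%MM us i] is u_(i+1), and [take i us] lists
   u_1, ..., u_i. *)
Definition linear_quotients I : Prop :=
  exists us : seq 'X_{1..n},
    [/\ uniq us,
        minimal_monomial_generators I [set` us]
      & forall i : nat, (0 < i < size us)%N ->
          exists V : set 'I_n,
            ideal_colon (monomial_span [set` take i us]) 'X_[nth 0%MM us i]
            = ideal_span [set 'X_j | j in V]].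

Inductive constructible : set S -> Prop :=
| constructible_principal (u : 'X_{1..n}) :
    constructible (ideal_span [set 'X_[u]])
| constructible_sum (q : nat) (I1 I2 : set S) :
    constructible I1 -> monomial_ideal_in_degree q I1 ->
    constructible I2 -> monomial_ideal_in_degree q I2 ->
    constructible (I1 `&` I2) ->
    monomial_ideal_in_degree q.+1 (I1 `&` I2) ->
    constructible (ideal_sum I1 I2).

End MonomialIdeals.

(* Main.v *)
Require Import Defs.
Local Open Scope classical_set_scope.
Local Open Scope ring_scope.

(* Adjoin the generators u_1, ..., u_m one at a time.  With
   J = (u_1, ..., u_(i-1)), one has J /\ (u_i) = u_i (J : u_i), which linear
   quotients make u_i (x_j : j in V).  Such an ideal is constructible by
   induction on the number of variables, for all monomials u at once, since
   u (x_j : j in V) /\ (u x_l) = (u x_l) (x_j : j in V) when l is not in V. *)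

Section MonomialSpan.
Set Implicit Arguments.
Unset Strict Implicit.
Import GRing.Theory.
Context {k : fieldType} {n : nat}.
Local Notation S := {mpoly k[n]}.
Implicit Types (f g : S) (G : set S) (M N L : set 'X_{1..n}) (m u : 'X_{1..n}).

Lemma ideal_span_is_ideal G : is_ideal (ideal_span G).
Proof.
split=> [A [[]]//|f g fG gG A|a f fG A] AG; case: (AG) => -[_ addA mulA] _.
  by apply: addA; [apply: fG|apply: gG].
by apply: mulA; apply: fG.
Qed.

(** The order [(g <= m)%MM] is componentwise, that is, divisibility of monomials. Ideals are handled
    below through these sets of exponents. *)
Definition multiples M : set 'X_{1..n} :=
  [set m | exists2 g, M g & (g <= m)%MM].

(** Polynomials supported on [multiples M] form an ideal containing the generators, hence the whole
    span. Conversely such a polynomial is the sum of its terms, each a multiple of a generator. *)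
Lemma monomial_spanP M f :
  monomial_span M f <-> forall m, m \in msupp f -> multiples M m.
Proof.
split.
  move: f; apply: smallest_sub => [|_ [m Mm <-] m'].
    split=> [m|f g fM gM m /msuppD_le|a f fM m /msuppM_le].
    - by rewrite msupp0.
    - by rewrite mem_cat => /orP[/fM|/gM].
    - move=> /allpairsP[[m1 m2] /= [_ /fM[g Mg gm2] ->]].
      by exists g => //; apply: lepm_trans gm2 (lem_addl _ _).
  by rewrite msuppX inE => /eqP ->; exists m => //; apply: lepm_refl.
have [span0 spanD spanM] := ideal_span_is_ideal [set 'X_[m] | m in M].
move=> fM; rewrite (mpolyE f) big_seq.
apply: (big_ind (monomial_span M)) => // m /fM[g Mg gm].
rewrite -mul_mpolyC -(submK gm) mpolyXD mulrA; apply: spanM.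
by apply: sub_gen_smallest; exists g.
Qed.

Lemma monomial_spanX M m : monomial_span M ('X_[m] : S) <-> multiples M m.
Proof.
split=> [/monomial_spanP/(_ m)|Mm]; first by rewrite msuppX inE eqxx; apply.
by apply/monomial_spanP => m'; rewrite msuppX inE => /eqP ->.
Qed.

Lemma monomial_spanS M N :
  M `<=` multiples N -> monomial_span (k := k) M `<=` monomial_span N.
Proof.
move=> MN f /monomial_spanP fM; apply/monomial_spanP => m /fM[g /MN[h Nh hg] gm].
by exists h => //; apply: lepm_trans gm.
Qed.

Lemma monomial_span1 u : monomial_span (k := k) [set u] = ideal_span [set 'X_[u]].
Proof. by rewrite /monomial_span image_set1. Qed.

Lemma multiples1 u m : multiples [set u] m <-> (u <= m)%MM.
Proof. by split=> [[_ ->]|um] //; exists u. Qed.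

Lemma monomial_spanI M N L :
  multiples M `&` multiples N = multiples L ->
  monomial_span M `&` monomial_span N = monomial_span (k := k) L.
Proof.
move=> MN; apply/seteqP; split=> f.
  case=> /monomial_spanP fM /monomial_spanP fN; apply/monomial_spanP => m mf.
  by rewrite -MN; split; [apply: fM|apply: fN].
by move=> /monomial_spanP fL; split; apply/monomial_spanP => m /fL;
  rewrite -MN => -[].
Qed.

(** Adjoining generators thus yields an [ideal_sum], the form that [constructible_sum] concludes
    about. *)
Lemma monomial_spanU M N :
  monomial_span (k := k) (M `|` N)
  = ideal_sum (monomial_span M) (monomial_span N).
Proof.
have [M0 MD MM] := ideal_span_is_ideal [set 'X_[m] | m in M].
have [N0 ND NM] := ideal_span_is_ideal [set 'X_[m] | m in N].
apply/seteqP; split=> [|_ [f fM [g gN <-]]].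
  apply: smallest_sub.
    split=> [|_ _ [f fM [f' fN <-]] [g gM [g' gN <-]]|a _ [f fM [g gN <-]]].
    - by exists 0 => //; exists 0 => //; rewrite addr0.
    - exists (f + g); first exact: MD.
      by exists (f' + g'); [exact: ND|rewrite addrACA].
    - exists (a * f); first exact: MM.
      by exists (a * g); [exact: NM|rewrite mulrDr].
  move=> _ [m [Mm|Nm] <-].
    exists 'X_[m]; first by apply: sub_gen_smallest; exists m.
    by exists 0 => //; rewrite addr0.
  exists 0 => //; exists 'X_[m]; last by rewrite add0r.
  by apply: sub_gen_smallest; exists m.
have [_ UD _] := ideal_span_is_ideal [set 'X_[m] | m in M `|` N].
by apply: UD; [move: f fM|move: g gN]; apply: monomial_spanS => m Mm;
  exists m; rewrite ?lepm_refl//; by [left|right].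
Qed.

Lemma monomial_span_in_degree q M :
  (forall m, M m -> mdeg m = q) ->
  monomial_ideal_in_degree q (monomial_span (k := k) M).
Proof. by exists M. Qed.

(** A minimal generator u is divisible by some v in N, of degree q, and v by some w in M. Minimality
    forces w = u, and then v = u. *)
Lemma minimal_generators_mdeg q (I : set S) M :
  minimal_monomial_generators I M -> monomial_ideal_in_degree q I ->
  forall u, M u -> mdeg u = q.
Proof.
move=> [MI Mmin] [N Nq IN] u Mu.
have /monomial_spanX[v Nv vu] : monomial_span N ('X_[u] : S).
  by rewrite -IN -MI; apply/monomial_spanX; exists u => //; apply: lepm_refl.
have /monomial_spanX[w Mw wv] : monomial_span M ('X_[v] : S).
  by rewrite MI IN; apply/monomial_spanX; exists v => //; apply: lepm_refl.
have [uw|/eqP wu] := eqVneq w u.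
  suff -> : u = v by apply: Nq.
  apply/mnmP => i; apply/eqP; rewrite eqn_leq (mnm_lepP vu) andbT.
  by rewrite -uw (mnm_lepP wv).
(* If w differs from u, then u is redundant because w divides it: [M] without u still spans I,
   against minimality. *)
suff MuM : M `\ u = M by move: Mu; rewrite -MuM => -[_ []].
apply: Mmin => [m []//|]; rewrite -MI.
apply/seteqP; split; apply: monomial_spanS => m Mm.
  by case: Mm => Mm _; exists m => //; apply: lepm_refl.
have [->|/eqP mu] := eqVneq m u; last by exists m => //; apply: lepm_refl.
by exists w => //; apply: lepm_trans wv vu.
Qed.

Definition var_multiples u (V : set 'I_n) : set 'X_{1..n} :=
  [set (u + U_(j))%MM | j in V].

(** The empty list is excluded because it gives the zero ideal, which is not constructible. *)
Lemma constructible_var_multiples u (s : seq 'I_n) :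
  s != [::] -> uniq s ->
  constructible (monomial_span (k := k) (var_multiples u [set` s])).
Proof.
elim: s u => // l s IHs u _ /= /andP[ls us].
have sE : var_multiples u [set` l :: s]
    = var_multiples u [set` s] `|` [set (u + U_(l))%MM].
  rewrite /var_multiples -(image_set1 (fun j => u + U_(j))%MM l) -image_setU.
  congr image; apply/seteqP; split=> j /=; rewrite inE.
    by move=> /orP[/eqP ->|]; [right|left].
  by case=> [->|->]; rewrite ?eqxx ?orbT.
have [s0|s_neq0] := eqVneq s [::].
  suff -> : var_multiples u [set` l :: s] = [set (u + U_(l))%MM].
    by rewrite monomial_span1; apply: constructible_principal.
  rewrite sE s0; apply/seteqP; split=> m; last by right.
  by case=> // -[j].
have degV v (V : set 'I_n) m : var_multiples v V m -> mdeg m = (mdeg v).+1.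
  by case=> j _ <-; rewrite mdegD mdeg1 addn1.
have sI : monomial_span (k := k) (var_multiples u [set` s])
      `&` monomial_span [set (u + U_(l))%MM]
    = monomial_span (var_multiples (u + U_(l))%MM [set` s]).
  apply: monomial_spanI; apply/seteqP; split=> m.
    case=> -[_ [j js <-] /mnm_lepP ujm] /multiples1/mnm_lepP ulm.
    exists (u + U_(l) + U_(j))%MM; first by exists j.
    apply/mnm_lepP => i; move: (ujm i) (ulm i); rewrite !mnmDE !mnm1E.
    (* The exponent bound at i is [ujm] when i differs from l; at l it is [ulm], because j differs
       from l. *)
    have [<-|li] := eqVneq l i; last by rewrite addn0.
    suff /negPf -> : j != l by rewrite !addn0.
    by apply: contraNneq ls => <-.
  case=> _ [j js <-] ujm; split.
    exists (u + U_(j))%MM; first by exists j.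
    by apply: lepm_trans ujm; rewrite -addmA (addmC U_(l)%MM) addmA lem_addr.
  by apply/multiples1; apply: lepm_trans ujm; rewrite lem_addr.
(* Both summands are generated in degree deg u + 1, and by [sI] their intersection in degree deg u +
   2. *)
rewrite sE monomial_spanU; apply: (@constructible_sum _ _ (mdeg u).+1).
- exact: IHs.
- by apply: monomial_span_in_degree => m; apply: degV.
- by rewrite monomial_span1; apply: constructible_principal.
- by apply: monomial_span_in_degree => _ ->; rewrite mdegD mdeg1 addn1.
- by rewrite sI; apply: IHs.
- rewrite sI; apply: monomial_span_in_degree => m /degV ->.
  by rewrite mdegD mdeg1 addn1.
Qed.

(** A monomial of (u) is u times a cofactor, and it lies in the span of M exactly when the cofactor
    lies in the colon ideal. *)
Lemma monomial_spanI_colon M u (V : set 'I_n) :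
  ideal_colon (monomial_span M) 'X_[u] = ideal_span [set ('X_j : S) | j in V] ->
  monomial_span M `&` monomial_span [set u]
  = monomial_span (k := k) (var_multiples u V).
Proof.
move=> MuV; apply: monomial_spanI.
have colonX m : multiples M (m + u)%MM <-> multiples [set U_(j)%MM | j in V] m.
  have := congr1 (fun A : set S => A 'X_[m]) MuV.
  rewrite /ideal_colon /= -mpolyXD.
  (* Since ['X_j] is the monomial with exponent [U_(j)], the ideal of variables becomes a
     [monomial_span]. *)
  rewrite -(image_comp (fun j : 'I_n => U_(j)%MM) (fun m' => 'X_[m'] : S)).
  by move=> colonE; rewrite -!monomial_spanX colonE.
apply/seteqP; split=> m.
  case=> Mm /multiples1 um; move: Mm; rewrite -(submK um).
  move=> /colonX[_ [j Vj <-] jm]; exists (u + U_(j))%MM; first by exists j.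
  by rewrite addmC; apply/mnm_lepP => i; rewrite !mnmDE leq_add2r (mnm_lepP jm).
case=> _ [j Vj <-] ujm.
have um : (u <= m)%MM by apply: lepm_trans ujm; apply: lem_addr.
split; last exact/multiples1.
rewrite -(submK um); apply/colonX; exists U_(j)%MM; first by exists j.
apply/mnm_lepP => i; move/mnm_lepP/(_ i): ujm.
by rewrite mnmBE mnmDE => uji; rewrite leq_subRL ?(mnm_lepP um).
Qed.

Lemma constructible_take q (us : seq 'X_{1..n}) :
  (forall u, u \in us -> mdeg u = q) ->
  (forall i : nat, (0 < i < size us)%N ->
     exists V : set 'I_n,
       ideal_colon (monomial_span [set` take i us]) 'X_[nth 0%MM us i]
       = ideal_span [set ('X_j : S) | j in V]) ->
  forall i : nat, (0 < i <= size us)%N ->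
    constructible (monomial_span (k := k) [set` take i us]).
Proof.
move=> degus colonus; elim=> // -[|i] IHi /= ilt.
  case: us {degus colonus IHi} ilt => // u us _ /=; rewrite take0.
  suff -> : [set` [:: u]] = [set u].
    by rewrite monomial_span1; apply: constructible_principal.
  by apply/seteqP; split=> m /=; rewrite inE => /eqP.
(* Indices are 0-based: [u] is the generator following the first i + 1, which span the ideal built
   so far. *)
have [V colonV] := colonus i.+1 ilt.
set J := [set` take i.+1 us] in colonV *; set u := nth _ _ _ in colonV.
have uJ : [set` take i.+2 us] = J `|` [set u].
  rewrite (take_nth 0%MM)//; apply/seteqP; split=> m /=; rewrite mem_rcons inE.
    by move=> /orP[/eqP ->|]; [right|left].
  by case=> [mJ|->]; rewrite ?eqxx// [X in _ || X]mJ orbT.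
have JI := monomial_spanI_colon colonV.
(* V is a subset of a finite type, so it can be listed without repetition, as
   [constructible_var_multiples] requires. *)
have VE : V = [set` enum (mem V)].
  by apply/seteqP; split=> j /=; rewrite mem_enum in_setE.
have degu : mdeg u = q by apply: degus; apply: mem_nth.
rewrite uJ monomial_spanU; apply: (@constructible_sum _ _ q).
- exact: IHi (ltnW ilt).
- by apply: monomial_span_in_degree => m /mem_take; apply: degus.
- by rewrite monomial_span1; apply: constructible_principal.
- by apply: monomial_span_in_degree => _ ->.
- rewrite JI VE; apply: constructible_var_multiples; last exact: enum_uniq.
  (* V is nonempty because the product of u_1 and u lies in the intersection. *)
  apply/negP => /eqP V0.
  have u1J : J (nth 0%MM us 0).
    rewrite /J /= -(@nth_take i.+1) ?mem_nth// size_take.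
    by case: ifP => // _; apply: leq_ltn_trans ilt.
  have : (monomial_span J `&` monomial_span [set u])
      ('X_[nth 0%MM us 0 + u] : S).
    split; apply/monomial_spanX.
      by exists (nth 0%MM us 0) => //; apply: lem_addr.
    by apply/multiples1; apply: lem_addl.
  by rewrite JI => /monomial_spanX[_ [j Vj _] _]; move: Vj; rewrite VE V0.
- rewrite JI; apply: monomial_span_in_degree => _ [j _ <-].
  by rewrite mdegD mdeg1 addn1 degu.
Qed.

End MonomialSpan.

Theorem proposition3p4p1 (k : fieldType) (n q : nat) (I : set {mpoly k[n]})
    (I_neq0 : I <> [set 0])
    (I_mon : monomial_ideal I)
    (I_linquot : linear_quotients I)
    (I_deg : monomial_ideal_in_degree q I) :
  constructible I.
Proof.
have [us [_ usI colonus]] := I_linquot.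
have degus := minimal_generators_mdeg usI I_deg.
have [spanI _] := usI.
(* An empty list of generators would make I the zero ideal. *)
have us_gt0 : (0 < size us)%N.
  rewrite lt0n; apply/negP => /nilP us0; apply: I_neq0; rewrite -spanI us0.
  apply/seteqP; split=> [f /monomial_spanP f0|_ ->].
    apply: msuppnil0; case: (msupp f) f0 => // m s /(_ m).
    by rewrite inE eqxx => /(_ isT)[].
  by case: (ideal_span_is_ideal (k := k) (n := n)
              [set 'X_[m] | m in [set` [::]]]).
rewrite -spanI -(take_size us).
by apply: (constructible_take degus colonus); rewrite us_gt0 leqnn.
Qed.
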